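(* Let $G$ be a completely metrizable topological group with identity $e$, let $d$ be a left-invariant compatible metric on $G$, let $\rho$ be a left-invariant continuous pseudometric on $G$, and let $T\colon G\to G$ be a continuous endomorphism of $G$. Suppose that $d$ is bounded or that $T$ is Lipschitz continuous with respect to $d$. Then the following assertions are equivalent: (1) $T$ admits a mean irregular point; (2) $T$ admits a mean Li-Yorke extremely chaotic pair; (3) $T$ is mean Li-Yorke extremely chaotic; (4) $T$ is mean Li-Yorke extremely sensitive; (5) the restriction of $T$ to some closed $T$-invariant subgroup $\widetilde{G}$ of $G$ has a dense (in $\widetilde G$) set of mean irregular points.
   Context: A topological group is completely metrizable if its topology is induced by some complete metric. A compatible metric $d$ on $G$ is a metric inducing the topology of $G$ (not required to be complete). A (pseudo)metric $d$ is left-invariant if $d(zx,zy)=d(x,y)$ for all $x,y,z\in G$. A continuous endomorphism is a continuous group homomorphism $G\to G$. $T$ is Lipschitz continuous if there is $L>0$ with $d(Tx,Ty)\le L\,d(x,y)$ for all $x,y\in G$. A subset $Y\subset G$ is $T$-invariant if $TY\subset Y$. All ''extreme'' and ''irregular'' notions are with respect to the fixed $\rho$: A point $x\in G$ is mean irregular for $T$ if $\liminf_{n\to\infty}\frac1n\sum_{i=1}^n d(T^ix,e)=0$ and $\limsup_{n\to\infty}\frac1n\sum_{i=1}^n \rho(T^ix,e)=\infty$. A pair $(x,y)\in G\times G$ is mean Li-Yorke extremely chaotic if $\liminf_{n\to\infty}\frac1n\sum_{i=1}^n d(T^ix,T^iy)=0$ and $\limsup_{n\to\infty}\frac1n\sum_{i=1}^n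 \rho(T^ix,T^iy)=\infty$. $T$ is mean Li-Yorke extremely chaotic if there exists an uncountable set $K\subset G$ such that any two distinct points of $K$ form a mean Li-Yorke extremely chaotic pair. $T$ is mean Li-Yorke extremely sensitive if for every $x\in G$ and $\varepsilon>0$ there exists $y\in G$ with $d(x,y)<\varepsilon$ such that $(x,y)$ is mean Li-Yorke extremely chaotic. *)

(* Defs.v *)
From HB Require Import structures.
From mathcomp Require Import all_boot all_order all_algebra.
From mathcomp Require Import all_classical all_reals all_analysis.

Set Implicit Arguments.
Unset Strict Implicit.
Unset Printing Implicit Defensive.

Import Order.TTheory GRing.Theory Num.Theory.
Import numFieldNormedType.Exports.

Local Open Scope classical_set_scope.
Local Open Scope ring_scope.

(* A multiplicative, not necessarily commutative, topological group. No
   separation axiom is included. *)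
HB.mixin Record isTopologicalGroup G & Topological G & Group G := {
  mulg_continuous : continuous (fun p : G * G => (p.1 * p.2)%g);
  invg_continuous : continuous (fun x : G => x^-1%g)
}.

#[short(type="topologicalGroupType")]
HB.structure Definition TopologicalGroup :=
  {G of Topological G & Group G & isTopologicalGroup G}.

Section Metrics.
Context {R : realType}.

Definition is_pseudometric (X : Type) (d : X -> X -> R) : Prop :=
  [/\ forall x y, 0 <= d x y,
      forall x, d x x = 0,
      forall x y, d x y = d y x &
      forall x y z, d x z <= d x y + d y z].

Definition is_metric (X : Type) (d : X -> X -> R) : Prop :=
  is_pseudometric d /\ forall x y, d x y = 0 -> x = y.

Definition induces_topology (X : topologicalType) (d : X -> X -> R) : Prop :=
  forall (x : X) (A : set X),
    nbhs x A <-> exists2 e : R, 0 < e & [set y | d x y < e] `<=` A.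

Definition compatible_metric (X : topologicalType) (d : X -> X -> R) : Prop :=
  is_metric d /\ induces_topology d.

Definition complete_metric (X : Type) (d : X -> X -> R) : Prop :=
  forall u : nat -> X,
    (forall e : R, 0 < e ->
       exists N, forall m n, (N <= m)%N -> (N <= n)%N -> d (u m) (u n) < e) ->
    exists l : X, forall e : R, 0 < e ->
       exists N, forall n, (N <= n)%N -> d (u n) l < e.

Definition continuous_pseudometric (X : topologicalType) (d : X -> X -> R) :
    Prop :=
  is_pseudometric d /\ continuous (fun p : X * X => d p.1 p.2).

Definition left_invariant (G : groupType) (d : G -> G -> R) : Prop :=
  forall x y z, d (z * x)%g (z * y)%g = d x y.

Definition bounded_metric (X : Type) (d : X -> X -> R) : Prop :=
  exists M : R, forall x y, d x y <= M.

Definition lipschitz_for (X : Type) (d : X -> X -> R) (T : X -> X) : Prop :=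
  exists2 L : R, 0 < L & forall x y, d (T x) (T y) <= L * d x y.

End Metrics.

Definition completely_metrizable (R : realType) (X : topologicalType) : Prop :=
  exists2 d : X -> X -> R, compatible_metric d & complete_metric d.

Section Subgroups.
Variable G : topologicalGroupType.

Definition is_subgroup (H : set G) : Prop :=
  [/\ H 1%g,
      forall x y, H x -> H y -> H (x * y)%g &
      forall x, H x -> H x^-1%g].

Definition invariant_set (T : G -> G) (Y : set G) : Prop := T @` Y `<=` Y.

Definition restrict_endo (T : G -> G) (H : set G) (TH : invariant_set T H)
  (x : H) : H := SigSub (mem_set (TH _ (imageP T (set_valP x)))).

Definition subgroup_one (H : set G) (sH : is_subgroup H) : H :=
  SigSub (mem_set (let: And3 h1 _ _ := sH in h1)).

End Subgroups.

Section MeanChaos.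
Context {R : realType} {X : Type}.
(* [d] is the metric, [rho] the pseudometric. *)
Variables (d rho : X -> X -> R) (T : X -> X).

(* The value at [n = 0] is 0; it does not affect the upper and lower limits.
   The means are extended reals so that an upper limit can equal +oo. *)
Definition orbit_mean (s : X -> X -> R) (x y : X) (n : nat) : \bar R :=
  (n%:R^-1 * \sum_(1 <= i < n.+1) s (iter i T x) (iter i T y))%:E.

Definition orbit_mean_to (s : X -> X -> R) (x e : X) (n : nat) : \bar R :=
  (n%:R^-1 * \sum_(1 <= i < n.+1) s (iter i T x) e)%:E.

(* [e] is the identity of the group under consideration. *)
Definition mean_irregular (e x : X) : Prop :=
  limn_einf (orbit_mean_to d x e) = 0%E /\
  limn_esup (orbit_mean_to rho x e) = +oo%E.

Definition mean_LY_extreme_pair (x y : X) : Prop :=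
  limn_einf (orbit_mean d x y) = 0%E /\
  limn_esup (orbit_mean rho x y) = +oo%E.

Definition mean_LY_extremely_chaotic : Prop :=
  exists2 K : set X, ~ countable K &
    forall x y, K x -> K y -> x <> y -> mean_LY_extreme_pair x y.

Definition mean_LY_extremely_sensitive : Prop :=
  forall (x : X) (eps : R), 0 < eps ->
    exists2 y : X, d x y < eps & mean_LY_extreme_pair x y.

End MeanChaos.

Definition restrict_dist (R : realType) (X : Type) (s : X -> X -> R)
  (H : set X) (x y : H) : R := s (set_val x) (set_val y).

(* [dense] refers to the subspace topology that [H], as a type, carries. *)
Definition dense_mean_irregular_restriction (R : realType)
    (G : topologicalGroupType) (d rho : G -> G -> R) (T : G -> G) (H : set G)
    (sH : is_subgroup H) (TH : invariant_set T H) : Prop :=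
  dense [set x : H | mean_irregular (@restrict_dist R G d H)
    (@restrict_dist R G rho H) (restrict_endo TH) (subgroup_one sH) x].

(* Main.v *)
Require Import Defs.
From HB Require Import structures.
From mathcomp Require Import all_boot all_order all_algebra.
From mathcomp Require Import all_classical all_reals all_analysis.
From mathcomp Require Import lra.

Set Implicit Arguments.
Unset Strict Implicit.
Unset Printing Implicit Defensive.

Import Order.TTheory GRing.Theory Num.Theory.
Import numFieldNormedType.Exports.

Local Open Scope classical_set_scope.
Local Open Scope ring_scope.

(** Averaging [s (T^i x) (T^i y)] over [1 <= i <= n] turns a left-invariant
    pseudometric [s] into another one, [mean_dist s T n], because [T] is an
    endomorphism. Write [d_n] and [rho_n] for these averages. A pair (x, y) is
    extremely chaotic when [d_n x y] has lower limit 0 and [rho_n x y] is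
    unbounded; by left invariance this depends on [x^-1 * y] only, and mean
    irregular points are those paired with 1, so one exists exactly when some
    pair is chaotic. The orbit of an irregular point [x] comes arbitrarily close
    to 1 and consists of irregular points; hence the points [y * T^k x] witness
    sensitivity at [y].

    For the uncountable chaotic set and the closed subgroup, choose [phi k >=
    k] along which [d_(phi k) x 1] tends to 0 and let [N] be the set of all
    points with this property, for the same [phi]. It is a subgroup by the
    triangle inequality. It is [T]-invariant when [d] is bounded or [T] is
    Lipschitz: in the first case applying [T] changes an average of [n] terms
    by at most a constant over [n], in the second it multiplies it by at most a
    constant. Let [H] be the closure of [N]. For every [y] in [H], the points
    of [H] that form an extremely chaotic pair with [y] contain a countable
    intersection of relatively open dense sets ([extreme_residual_subgroup]).
    By translation take [y = 1]; density holds because a point [a] of [N] with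
    small [rho]-averages can be replaced by [a * T^k x], whose [rho]-averages
    are as large as those of [T^k x] up to a bounded error.

    The Baire property of [H] then makes the irregular points dense in [H]. It
    also yields an uncountable chaotic set: by Zorn's lemma there is a maximal
    set of points of [H] that are pairwise extremely chaotic. If it were
    countable, the Baire property would provide a point that is chaotic with
    all of its members, against maximality ([uncountable_extreme_set]). *)

(** * Upper and lower limits of real sequences *)

Section UpperAndLowerLimits.
Variable R : realType.
Implicit Types u : nat -> R.

Lemma limn_esup_pinftyP u :
  limn_esup (fun n => (u n)%:E) = +oo%E <->
  forall A N, exists2 n, (N <= n)%N & A < u n.
Proof.
rewrite /limn_esup /limf_esup; split=> [/ereal_inf_pinfty supoo A N|uoo].
  have : (A%:E < ereal_sup [set (u n)%:E | n in [set n | (N <= n)%N]])%E.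
    rewrite (supoo (ereal_sup _)) ?ltry//.
    by exists [set n | (N <= n)%N] => //; exact: nbhs_infty_ge.
  by case/ereal_sup_gt=> _ [n Nn <-]; rewrite lte_fin; exists n.
apply/ereal_inf_pinfty => _ [V [N _ NV] <-]; apply/eqyP => A _.
have [n Nn Au] := uoo A N.
apply: (@le_trans _ _ (u n)%:E); first by rewrite lee_fin ltW.
by apply: ereal_sup_ubound; exists n => //; exact: NV.
Qed.

Lemma limn_einf_eq0P u : (forall n, 0 <= u n) ->
  limn_einf (fun n => (u n)%:E) = 0%E <->
  forall e N, 0 < e -> exists2 n, (N <= n)%N & u n < e.
Proof.
move=> u0; rewrite /limn_einf /limn_esup /limf_esup.
set S := [set ereal_sup _ | _ in _]; split=> [/eqP|unear].
  rewrite eqe_oppLR oppe0 => /eqP inf0 e N e0.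
  have : ((- e)%:E <
      ereal_sup [set (- (u n)%:E)%E | n in [set n | (N <= n)%N]])%E.
    apply: (@lt_le_trans _ _ (ereal_inf S));
      first by rewrite inf0 lte_fin oppr_lt0.
    apply: ereal_inf_lbound.
    by exists [set n | (N <= n)%N] => //; exact: nbhs_infty_ge.
  case/ereal_sup_gt=> _ [n Nn <-]; rewrite -EFinN lte_fin ltrN2 => ?.
  by exists n.
apply/eqP; rewrite eqe_oppLR oppe0; apply/eqP/le_anti/andP; split.
  apply: (@le_trans _ _ (ereal_sup [set (- (u n)%:E)%E | n in setT])).
    by apply: ereal_inf_lbound; exists setT => //; exact: filterT.
  by apply: ge_ereal_sup => _ [n _ <-]; rewrite -EFinN lee_fin oppr_le0.
apply/ereal_infP => _ [V [N _ NV] <-]; apply/lee_addgt0Pr => e e0.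
have [n Nn ue] := unear e N e0.
rewrite -leeBlDr// sub0e; apply: (@le_trans _ _ (- (u n)%:E)%E).
  by rewrite leeN2 lee_fin ltW.
by apply: ereal_sup_ubound; exists n => //; exact: NV.
Qed.

End UpperAndLowerLimits.

(** * Averages of a pseudometric along orbits *)

Section MeanDistance.
Context {R : realType} {X : Type}.
Implicit Types (s : X -> X -> R) (T : X -> X).

Definition mean_dist s T n x y : R :=
  n%:R^-1 * \sum_(1 <= i < n.+1) s (iter i T x) (iter i T y).

(** Valid also at [n = 0], where both sides vanish. *)
Lemma mean_dist_sum s T n x y :
  n%:R * mean_dist s T n x y =
  \sum_(1 <= i < n.+1) s (iter i T x) (iter i T y).
Proof.
case: n => [|n]; first by rewrite mul0r big_geq.
by rewrite mulrA divff ?mul1r ?pnatr_eq0.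
Qed.

Lemma mean_dist_pseudometric s T n :
  is_pseudometric s -> is_pseudometric (mean_dist s T n).
Proof.
move=> [s0 sxx sC str]; split.
- by move=> x y; rewrite mulr_ge0 ?sumr_ge0.
- by move=> x; rewrite /mean_dist big1 ?mulr0.
- by move=> x y; congr (_ * _); apply: eq_bigr => i _; rewrite sC.
- move=> x y z; rewrite -mulrDr ler_wpM2l// -big_split/=.
  by apply: ler_sum => i _; exact: str.
Qed.

(** The orbit of [T x] is that of [x] without its first term, so
    the averages along the two orbits are comparable. *)
Lemma mean_dist_step s T n x y :
  n%:R * mean_dist s T n (T x) (T y) + s (T x) (T y) =
  n.+1%:R * mean_dist s T n.+1 x y.
Proof.
rewrite !mean_dist_sum [RHS]big_nat_recl//= addrC; congr (_ + _).
by apply: eq_bigr => i _; rewrite -!iterSr.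
Qed.

Lemma mean_dist_image_le s T n x y : is_pseudometric s ->
  mean_dist s T n (T x) (T y) <= 2 * mean_dist s T n.+1 x y.
Proof.
move=> ps; have [s0 _ _ _] := ps.
have [m0 _ _ _] := mean_dist_pseudometric T n.+1 ps.
case: n m0 => [|n] m0.
  by rewrite {1}/mean_dist big_geq// mulr0 mulr_ge0.
rewrite -(@ler_pM2l _ n.+1%:R) ?ltr0n//.
have := mean_dist_step s T n.+1 x y; have := s0 (T x) (T y); have := m0 x y.
have : (0 : R) <= n%:R by [].
rewrite !mulrS; nra.
Qed.

Lemma mean_dist_image_ge s T n x y : is_pseudometric s ->
  mean_dist s T n.+1 x y <= mean_dist s T n (T x) (T y) + s (T x) (T y).
Proof.
move=> ps; have [s0 _ _ _] := ps.
have [m0 _ _ _] := mean_dist_pseudometric T n ps.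
rewrite -(@ler_pM2l _ n.+1%:R) ?ltr0n//.
have := mean_dist_step s T n x y; have := s0 (T x) (T y).
have := m0 (T x) (T y); have : (0 : R) <= n%:R by [].
rewrite !mulrS; nra.
Qed.

Lemma mean_dist_lipschitz s T L n x y :
  (forall x y, s (T x) (T y) <= L * s x y) ->
  mean_dist s T n (T x) (T y) <= L * mean_dist s T n x y.
Proof.
move=> TL; rewrite mulrCA ler_wpM2l// mulr_sumr.
by apply: ler_sum => i _; rewrite -!iterSr; exact: TL.
Qed.

(** The two sums differ only in their extreme terms, so dividing by [n] leaves
    an error of at most [M / n]. *)
Lemma mean_dist_bounded s T M n x y :
  is_pseudometric s -> (forall x y, s x y <= M) ->
  mean_dist s T n (T x) (T y) <= mean_dist s T n x y + n%:R^-1 * M.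
Proof.
move=> [s0 _ _ _] sM; rewrite -mulrDr ler_wpM2l//.
rewrite -(lerD2r (s (T x) (T y))).
apply: (@le_trans _ _ (\sum_(1 <= i < n.+2) s (iter i T x) (iter i T y))).
  by rewrite -!mean_dist_sum mean_dist_step.
rewrite big_nat_recr//= -addrA lerD2l.
by apply: (le_trans (sM _ _)); rewrite lerDl.
Qed.

(** An average is at least its smallest term. *)
Lemma mean_dist_lt s T n x y e : (0 < n)%N -> mean_dist s T n x y < e ->
  exists k, s (iter k T x) (iter k T y) < e.
Proof.
move=> n0 me; apply: contrapT => /forallNP se.
suff : e <= mean_dist s T n x y by rewrite leNgt me.
rewrite -(@ler_pM2l _ n%:R) ?ltr0n// mean_dist_sum mulr_natl.
rewrite -{1}[n](subn1 n.+1) -sumr_const_nat.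
by apply: ler_sum => i _; rewrite leNgt; exact/negP.
Qed.

Lemma mean_LY_extreme_pairP d rho T x y : is_pseudometric d ->
  mean_LY_extreme_pair d rho T x y <->
  (forall e N, 0 < e -> exists2 n, (N <= n)%N & mean_dist d T n x y < e) /\
  (forall A N, exists2 n, (N <= n)%N & A < mean_dist rho T n x y).
Proof.
move=> pd; rewrite /mean_LY_extreme_pair.
rewrite -(limn_esup_pinftyP (fun n => mean_dist rho T n x y)).
rewrite -(@limn_einf_eq0P _ (fun n => mean_dist d T n x y))// => n.
by have [m0 _ _ _] := mean_dist_pseudometric T n pd.
Qed.

End MeanDistance.

(** * Baire category in closed subsets *)

Section MetricTopology.
Context {R : realType} {X : topologicalType}.
Implicit Types (D d : X -> X -> R) (H : set X).

Lemma metric_ball_nbhs D x e : compatible_metric D -> 0 < e ->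
  nbhs x [set y | D x y < e].
Proof. by move=> [_ Dtop] e0; apply/Dtop; exists e. Qed.

Lemma compatible_metric_continuous D :
  compatible_metric D -> continuous_pseudometric D.
Proof.
move=> cD; have [[pD _] _] := cD; have [D0 _ DC Dtr] := pD.
split=> // -[x y]; apply/cvgrPdist_lt => e e0 /=.
have e2 : 0 < e / 2 by rewrite divr_gt0.
exists ([set z | D x z < e / 2], [set z | D y z < e / 2]) => /=.
  by split; exact: metric_ball_nbhs.
move=> [x' y'] /= [xx' yy'].
rewrite ltr_distlC.
have := Dtr x x' y; have := Dtr x' y' y; have := Dtr x' x y'.
have := Dtr x y y'; rewrite (DC x' x) (DC y' y) => ? ? ? ?.
by apply/andP; split; lra.
Qed.

(** The usual nested closed balls, centred in [H], with respect to a complete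
    compatible metric. Phrasing density in [H] by closures in [X] avoids the
    subspace topology. *)
Lemma Baire_closed (H : set X) (O : nat -> set X) :
  completely_metrizable R X -> closed H -> (forall n, open (O n)) ->
  (forall n, H `<=` closure (H `&` O n)) ->
  H `<=` closure (H `&` \bigcap_n O n).
Proof.
move=> [D cD Dcomplete] clH opO dO x Hx B Bx.
have [[[D0 Dxx DC Dtr] _] Dtop] := cD.
pose good (p : X * R) := H p.1 /\ 0 < p.2.
pose cball (p : X * R) := [set z | D p.1 z <= p.2].
pose next (np : nat * (X * R)) q := good np.2 ->
  [/\ good q, q.2 <= np.1.+1%:R^-1 & cball q `<=` O np.1 `&` cball np.2].
have nextP np : exists q, next np q.
  case: np => n p; have [gp|ngp] := pselect (good p); last by exists p.
  have [Hp p0] := gp.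
  have [y [[Hy Oy] py]] := dO n _ Hp _ (metric_ball_nbhs p.1 cD p0).
  have : nbhs y (O n) by apply: open_nbhs_nbhs; split.
  move=> /Dtop[e e0 eO].
  (* The three bounds make the radii tend to 0 and keep the closed ball inside
     [O n] and inside the previous ball. *)
  pose r := Num.min (Num.min n.+1%:R^-1 (e / 2)) (p.2 - D p.1 y).
  have r0 : 0 < r by rewrite !lt_min invr_gt0 ltr0n divr_gt0//= subr_gt0.
  exists (y, r) => _; split=> //.
    by rewrite /r/= !ge_min lexx.
  move=> z; rewrite /cball/= !le_min => /andP[/andP[_ yze] yzp].
  split.
    apply: eO => /=.
    by rewrite (le_lt_trans yze)// ltr_pdivrMr// ltr_pMr// ltr1n.
  by apply: (le_trans (Dtr _ y _)); rewrite addrC -lerBrDr.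
have [f fP] := choice nextP.
have /Dtop[e e0 eB] := Bx.
(* Centre and radius; radius [e / 2] keeps the first closed ball inside [B]. *)
pose u := fix u n := if n is m.+1 then f (m, u m) else (x, e / 2).
have gu n : good (u n).
  elim: n => [|n IH /=]; first by split=> //=; rewrite divr_gt0.
  by have [] := fP (n, u n) IH.
have uS n : (u n.+1).2 <= n.+1%:R^-1 /\ cball (u n.+1) `<=` O n `&` cball (u n).
  by have [_ ? ?] := fP (n, u n) (gu n).
have u0 : u 0%N = (x, e / 2) by [].
clearbody u.
have ball_le m n : (m <= n)%N -> cball (u n) `<=` cball (u m).
  move=> /subnKC <-; elim: (n - m)%N => [|k IH]; first by rewrite addn0.
  by rewrite addnS => z /(uS _).2[_] /IH.
have cu m n : (m <= n)%N -> D (u m).1 (u n).1 <= (u m).2.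
  by move=> /ball_le; apply; rewrite /cball/= Dxx ltW//; case: (gu n).
have [eps eps0|l ul] := Dcomplete (fun n => (u n).1).
  have eps2 : 0 < eps / 2 by rewrite divr_gt0.
  have [N _ Neps] := near_infty_natSinv_lt (PosNum eps2).
  exists N.+1 => m n Nm Nn.
  have uN k : (N < k)%N -> D (u N.+1).1 (u k).1 < eps / 2.
    move=> /cu/le_lt_trans; apply.
    exact: le_lt_trans (uS N).1 (Neps _ (leqnn N)).
  rewrite (le_lt_trans (Dtr _ (u N.+1).1 _))// [ltRHS]splitr ltrD ?uN//.
  by rewrite DC uN.
have cl n : cball (u n) l.
  rewrite /cball/=; apply/ler_addgt0Pr => eps /ul[N Nl].
  have /= := Nl _ (leq_maxr n N); have := cu _ _ (leq_maxl n N).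
  by have := Dtr (u n).1 (u (maxn n N)).1 l; lra.
exists l; split; last first.
  have := cl 0%N; rewrite u0 => xl.
  by apply: eB => /=; rewrite (le_lt_trans xl)// ltr_pdivrMr// ltr_pMr// ltr1n.
split; last by move=> n _; have [] := (uS n).2 _ (cl n.+1).
apply: clH => C /Dtop[eps /ul[N Nl] epsC]; exists (u N).1; split.
  by case: (gu N).
by apply: epsC => /=; rewrite DC; exact: Nl.
Qed.

Lemma Baire_closed_countable (I : Type) (K : set I) (H : set X)
    (O : I -> set X) :
  completely_metrizable R X -> closed H -> countable K ->
  (forall i, K i -> open (O i)) ->
  (forall i, K i -> H `<=` closure (H `&` O i)) ->
  H `<=` closure (H `&` \bigcap_(i in K) O i).
Proof.
move=> cX clH /pfcard_geP[->|[f]] opO dO.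
  by rewrite bigcap_set0 setIT; exact: subset_closure.
have fK n : K (f n) by exact: funS.
have -> : \bigcap_(i in K) O i = \bigcap_n O (f n).
  apply/seteqP; split=> [y Oy n _|y Oy i Ki]; first exact: Oy.
  by have [n _ <-] := @surj _ _ _ _ f i Ki; exact: Oy.
by apply: Baire_closed => // n; [exact: opO | exact: dO].
Qed.

End MetricTopology.

(** * Left-invariant pseudometrics and endomorphisms *)

Section LeftInvariant.
Context {R : realType} {G : groupType} (s : G -> G -> R).
Hypotheses (ps : is_pseudometric s) (sinv : left_invariant s).

Lemma linv_dist1 x y : s x y = s (x^-1 * y)%g 1%g.
Proof.
have [_ _ sC _] := ps.
by rewrite -(sinv x y x^-1%g) mulVg sC.
Qed.

Lemma linv_dist1V x : s x^-1%g 1%g = s x 1%g.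
Proof. by have [_ _ sC _] := ps; rewrite [RHS]linv_dist1 mulg1. Qed.

Lemma linv_dist1M x y : s (x * y)%g 1%g <= s x 1%g + s y 1%g.
Proof.
have [_ _ _ str] := ps; have := str (x * y)%g x 1%g.
have -> : s (x * y)%g x = s y 1%g by rewrite -{2}[x]mulg1 sinv.
by rewrite addrC.
Qed.

Lemma linv_dist1_subr x y : s y 1%g - s x 1%g <= s (x * y)%g 1%g.
Proof.
rewrite lerBlDl -[in leLHS](mulKg x y) -(linv_dist1V x).
exact: linv_dist1M.
Qed.

End LeftInvariant.

Section Endomorphism.
Context {R : realType} {G : topologicalGroupType} (T : {multiplicative G -> G}).
Implicit Types s : G -> G -> R.

Lemma iter_endoM n : {morph iter n T : x y / (x * y)%g}.
Proof. by elim: n => [|n IH] x y //=; rewrite IH gmulfM. Qed.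

Lemma endo1 : T 1%g = 1%g.
Proof. by apply: (@mulgI _ (T 1%g)); rewrite -gmulfM !mulg1. Qed.

Lemma iter_endo1 n : iter n T 1%g = 1%g.
Proof. by elim: n => //= n ->; exact: endo1. Qed.

(** Averaging preserves left invariance because each [T^i] is an endomorphism;
    this is what reduces pairs to single points. *)
Lemma mean_dist_linv s n : left_invariant s -> left_invariant (mean_dist s T n).
Proof.
move=> sinv x y z; congr (_ * _).
by apply: eq_bigr => i _; rewrite !iter_endoM sinv.
Qed.

Lemma mean_dist_continuous s n x : continuous_pseudometric s -> continuous T ->
  continuous (mean_dist s T n x).
Proof.
move=> [_ sc] Tc y; rewrite /mean_dist; apply: cvgM; first exact: cvg_cst.
apply: cvg_big => [|i _]; first exact: add_continuous.
have Tic : {for y, continuous (iter i T)}.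
  elim: i => [|i IH]; first exact: cvg_id.
  exact: (continuous_comp IH (Tc _)).
apply: (@continuous_comp _ _ _ (fun z => (iter i T x, iter i T z))
  (fun p => s p.1 p.2)).
  by apply: cvg_pair => //; exact: cvg_cst.
exact: sc.
Qed.

Lemma mean_irregularE (d rho : G -> G -> R) x :
  mean_irregular d rho T 1%g x = mean_LY_extreme_pair d rho T x 1%g.
Proof.
have E s : orbit_mean_to T s x 1%g = orbit_mean T s x 1%g :> (nat -> \bar R).
  apply/funext => n; congr (_ * _)%:E.
  by apply: eq_bigr => i _; rewrite iter_endo1.
by rewrite /mean_irregular !E.
Qed.

End Endomorphism.

Section Subgroups.
Variable G : topologicalGroupType.
Implicit Types N : set G.

Lemma closure_subgroup N : is_subgroup N -> is_subgroup (closure N).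
Proof.
move=> [N1 NM NV]; split; first exact: subset_closure.
- move=> x y clx cly B Bxy.
  have [[U V] /= [Ux Vy] UVB] := @mulg_continuous G (x, y) B Bxy.
  have [a [Na Ua]] := clx _ Ux; have [b [Nb Vb]] := cly _ Vy.
  by exists (a * b)%g; split; [exact: NM | exact: (UVB (a, b))].
- move=> x clx B Bx.
  have [a [Na Ba]] := clx _ (@invg_continuous G x B Bx).
  by exists a^-1%g; split => //; exact: NV.
Qed.

Lemma closure_invariant N (T : G -> G) : continuous T ->
  invariant_set T N -> invariant_set T (closure N).
Proof.
move=> Tc TN _ [x clx <-] B BTx.
have [a [Na Ba]] := clx _ (Tc x B BTx).
by exists (T a); split => //; apply: TN; exists a.
Qed.

End Subgroups.

(** * Extremely chaotic pairs *)

Section MeanChaoticPairs.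
Context {R : realType} {G : topologicalGroupType}.
Variables (d rho : G -> G -> R) (T : {multiplicative G -> G}).
Hypotheses (d_compat : compatible_metric d) (d_linv : left_invariant d).
Hypotheses (rho_cont : continuous_pseudometric rho)
  (rho_linv : left_invariant rho).
Hypothesis T_cont : continuous T.

Let pd : is_pseudometric d. Proof. by case: d_compat => -[]. Qed.
Let prho : is_pseudometric rho. Proof. by case: rho_cont. Qed.
Let pdn n := mean_dist_pseudometric T n pd.
Let prhon n := mean_dist_pseudometric T n prho.
Let dn_linv n := mean_dist_linv T n d_linv.
Let rhon_linv n := mean_dist_linv T n rho_linv.

Local Notation extreme := (mean_LY_extreme_pair d rho T).
Local Notation dn := (mean_dist d T).
Local Notation rhon := (mean_dist rho T).

Lemma extreme_pair_translate z x y :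
  extreme (z * x)%g (z * y)%g <-> extreme x y.
Proof.
have E s n : left_invariant s ->
    orbit_mean T s (z * x)%g (z * y)%g n = orbit_mean T s x y n :> \bar R.
  by move=> sl; congr (_%:E); exact: mean_dist_linv.
rewrite /mean_LY_extreme_pair.
by rewrite (funext (fun n => E d n d_linv))
  (funext (fun n => E rho n rho_linv)).
Qed.

Lemma extreme_pair_sym x y : extreme x y -> extreme y x.
Proof.
move=> /(mean_LY_extreme_pairP _ _ _ _ pd)[dxy rxy].
apply/(mean_LY_extreme_pairP _ _ _ _ pd); split=> [e N e0|A N].
  by have [n Nn ?] := dxy e N e0; exists n => //; have [_ _ -> _] := pdn n.
by have [n Nn ?] := rxy A N; exists n => //; have [_ _ -> _] := prhon n.
Qed.

Lemma extreme_pair1 x y : extreme x y <-> extreme (x^-1 * y)%g 1%g.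
Proof.
rewrite -(extreme_pair_translate x^-1%g) mulVg.
by split; exact: extreme_pair_sym.
Qed.

Lemma extreme_pair_irrefl x : ~ extreme x x.
Proof.
move=> /(mean_LY_extreme_pairP _ _ _ _ pd)[_ /(_ 0 0%N)[n _]].
by have [_ -> _ _] := prhon n; rewrite ltxx.
Qed.

(** Passing from [x, y] to [T x, T y] at most doubles the averages of [d], and
    lowers those of [rho] by at most a constant. *)
Lemma extreme_pair_image x y : extreme x y -> extreme (T x) (T y).
Proof.
move=> /(mean_LY_extreme_pairP _ _ _ _ pd)[dxy rxy].
apply/(mean_LY_extreme_pairP _ _ _ _ pd); split=> [e N e0|A N].
  have [[//|n] Nn ne] := dxy (e / 2) N.+1 (divr_gt0 e0 (ltr0Sn _ 1)).
  exists n => //; apply: le_lt_trans (mean_dist_image_le T n x y pd) _.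
  by rewrite mulrC -ltr_pdivlMr.
have [[//|n] Nn An] := rxy (A + rho (T x) (T y)) N.+1.
exists n => //; rewrite -(ltrD2r (rho (T x) (T y))).
exact: lt_le_trans An (mean_dist_image_ge T n x y prho).
Qed.

Lemma extreme_pair_iter k x : extreme x 1%g -> extreme (iter k T x) 1%g.
Proof.
move=> x1; elim: k => //= k /extreme_pair_image.
by rewrite endo1.
Qed.

Lemma extreme_pair_orbit_near1 x e : extreme x 1%g -> 0 < e ->
  exists k, d (iter k T x) 1%g < e.
Proof.
move=> /(mean_LY_extreme_pairP _ _ _ _ pd)[dx _] e0.
have [n n0 /(mean_dist_lt n0)[k]] := dx e 1%N e0.
by rewrite iter_endo1; exists k.
Qed.

(** Translating to [y] a point of the orbit of [x] that is close to 1. *)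
Lemma extreme_pair_sensitive x :
  extreme x 1%g -> mean_LY_extremely_sensitive d rho T.
Proof.
move=> x1 y e e0; have [k kx] := extreme_pair_orbit_near1 x1 e0.
have [_ _ dC _] := pd.
exists (y * iter k T x)%g.
  by rewrite (linv_dist1 pd d_linv) mulKg.
by apply/extreme_pair1; rewrite mulKg; exact: extreme_pair_iter.
Qed.

(** Finite-stage approximations: open conditions whose intersection over all
    [j] says that (x, y) is extremely chaotic. *)
Definition extreme_up_to j x := [set y |
  (exists2 n, (j <= n)%N & dn n x y < j.+1%:R^-1) /\
  (exists2 n, (j <= n)%N & j%:R < rhon n x y)].

Lemma bigcap_extreme_up_to x : \bigcap_j extreme_up_to j x = extreme x.
Proof.
apply/seteqP; split=> y; last first.
  move=> /(mean_LY_extreme_pairP _ _ _ _ pd)[dxy rxy] j _.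
  by split; [exact: dxy | exact: rxy].
move=> xy; apply/(mean_LY_extreme_pairP _ _ _ _ pd); split=> [e N e0|A N].
  have [M _ Me] := near_infty_natSinv_lt (PosNum e0).
  have [[n jn ne] _] := xy (maxn M N) I.
  exists n; first exact: leq_trans (leq_maxr M N) jn.
  exact: lt_trans ne (Me _ (leq_maxl M N)).
have [_ [n jn An]] := xy (maxn (Num.truncn A).+1 N) I.
exists n; first exact: leq_trans (leq_maxr _ N) jn.
apply: lt_trans An; apply: (lt_le_trans (truncnS_gt A)).
by rewrite ler_nat leq_maxl.
Qed.

Lemma open_extreme_up_to j x : open (extreme_up_to j x).
Proof.
have -> : extreme_up_to j x =
    (\bigcup_(n in [set n | (j <= n)%N])
      (dn n x @^-1` [set r | r < j.+1%:R^-1])) `&`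
    (\bigcup_(n in [set n | (j <= n)%N]) (rhon n x @^-1` [set r | j%:R < r])).
  by apply/seteqP; split=> y [[n ? ?] [m ? ?]]; split;
    [exists n|exists m|exists n|exists m].
apply: openI; apply: bigcup_open => n _.
  apply: open_comp => [y _|]; last exact: open_lt.
  exact: mean_dist_continuous (compatible_metric_continuous d_compat) T_cont _.
apply: open_comp => [y _|]; last exact: open_gt.
exact: mean_dist_continuous rho_cont T_cont _.
Qed.

(** The times [phi] do not depend on the point: products preserve convergence
    to 0 along common times, but not lower limit 0 along times that vary from
    point to point. *)
Definition mean_null (phi : nat -> nat) :=
  [set a | dn (phi k) a 1%g @[k --> \oo] --> (0 : R)].

Lemma mean_null_subgroup phi : is_subgroup (mean_null phi).
Proof.
split=> [|a b a0 b0|a a0]; rewrite /mean_null/=.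
- apply: cvg_near_cst; near=> k.
  by have [_ -> _ _] := pdn (phi k).
- apply: (@squeeze_cvgr _ _ _ _ (fun=> 0)
    (fun k => dn (phi k) a 1%g + dn (phi k) b 1%g)).
  + near=> k; have [-> _ _ _] := pdn (phi k).
    exact: (linv_dist1M (pdn (phi k)) (dn_linv (phi k))).
  + exact: cvg_cst.
  + by rewrite -[0]addr0; exact: cvgD.
- under eq_fun do rewrite (linv_dist1V (pdn _) (dn_linv _)).
  exact: a0.
Unshelve. all: by end_near. Qed.

(** If [d] is bounded, applying [T] adds at most [M / phi k] to the averages,
    and [phi k >= k] tends to infinity; if [T] is Lipschitz, it multiplies them
    by at most a constant. *)
Lemma mean_null_invariant phi : (forall k, (k <= phi k)%N) ->
  bounded_metric d \/ lipschitz_for d T -> invariant_set T (mean_null phi).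
Proof.
move=> phik dT _ [a a0 <-]; rewrite /mean_null/=.
suff [f f0 fT] : exists2 f : nat -> R, f @ \oo --> (0 : R) &
    \forall k \near \oo, dn (phi k) (T a) (T 1%g) <= f k.
  apply: (squeeze_cvgr _ (cvg_cst 0) f0); near=> k.
  have [-> _ _ _] := pdn (phi k).
  by rewrite -(endo1 T) /=; near: k; exact: fT.
case: dT => [[M dM]|[L L0 TL]].
  exists (fun k => dn (phi k) a 1%g + (phi k)%:R^-1 * M).
    rewrite -[0]addr0; apply: cvgD => //.
    rewrite -[0](mul0r M); apply: cvgM; last exact: cvg_cst.
    apply/gtr0_cvgV0.
      near=> k; rewrite ltr0n (leq_trans _ (phik k))//.
      by near: k; exact: nbhs_infty_gt.
    apply/cvgrnyP/cvgnyPge => A; near=> k; apply: leq_trans (phik k).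
    by near: k; exact: nbhs_infty_ge.
  by apply: nearW => k; exact: mean_dist_bounded.
exists (fun k => L * dn (phi k) a 1%g).
  by rewrite -[0](mulr0 L); apply: cvgM => //; exact: cvg_cst.
by apply: nearW => k; exact: mean_dist_lipschitz.
Unshelve. all: by end_near. Qed.

(** [H] is the closure of [mean_null phi], with [phi] adapted to [x]. On this
    dense subgroup the condition on [d] holds automatically, and the one on
    [rho] can be forced by multiplying by a point of the orbit of [x]. *)
Lemma extreme_residual_subgroup x :
  bounded_metric d \/ lipschitz_for d T -> extreme x 1%g ->
  exists H, [/\ is_subgroup H, invariant_set T H, closed H &
    forall y j, H y -> H `<=` closure (H `&` extreme_up_to j y)].
Proof.
move=> dT x1; have [dx rx] := (mean_LY_extreme_pairP _ _ _ _ pd).1 x1.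
have /choice[phi phiP] k : exists n, (k <= n)%N /\ dn n x 1%g < k.+1%:R^-1.
  by have [n kn nx] := dx k.+1%:R^-1 k ltac:(by rewrite invr_gt0); exists n.
pose N := mean_null phi.
have sN : is_subgroup N := mean_null_subgroup phi.
have TN : invariant_set T N.
  by apply: mean_null_invariant => // k; have [] := phiP k.
have Nx : N x.
  apply: (squeeze_cvgr _ (cvg_cst 0) cvg_harmonic); near=> k.
  by have [-> _ _ _] := pdn (phi k); rewrite ltW//; have [] := phiP k.
have Nkx k : N (iter k T x).
  by elim: k => //= k IH; apply: TN; exists (iter k T x).
have [N1 NM NV] := sN.
have N_near a j : N a -> exists2 n, (j <= n)%N & dn n 1%g a < j.+1%:R^-1.
  move=> Na; have j0 : 0 < j.+1%:R^-1 :> R by rewrite invr_gt0.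
  near \oo => k; exists (phi k).
    apply: (@leq_trans k); last by have [] := phiP k.
    by near: k; exact: nbhs_infty_ge.
  have [_ _ -> _] := pdn (phi k).
  by near: k; exact: cvgr_lt j0.
have dense1 j : closure N `<=` closure (N `&` extreme_up_to j 1%g).
  move=> z clz B; rewrite nbhsE; case=> O [opO Oz] OB.
  have [a [Na Oa]] := clz _ (open_nbhs_nbhs (conj opO Oz)).
  have [[n [jn an]]|rho_small] :=
      pselect (exists n, (j <= n)%N /\ j%:R < rhon n 1%g a).
    by exists a; split; [split=> //; split; [exact: N_near|exists n]|exact: OB].
  have /(d_compat.2)[e e0 eO] := open_nbhs_nbhs (conj opO Oa).
  (* The averages of [rho] at [a] stay below [j], those of [T^k x] exceed [2 j]
     at some time, so those of [a * T^k x] exceed [j] at that time. *)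
  have [k kx] := extreme_pair_orbit_near1 x1 e0.
  exists (a * iter k T x)%g; split; last first.
    apply: OB; apply: eO => /=.
    by rewrite (linv_dist1 pd d_linv) mulKg.
  have Nb : N (a * iter k T x)%g by exact: NM.
  split=> //; split; first exact: N_near.
  have [_ rkx] := (mean_LY_extreme_pairP _ _ _ _ pd).1 (extreme_pair_iter k x1).
  have [n jn nkx] := rkx (j%:R + j%:R) j; exists n => //.
  have [_ _ rC _] := prhon n.
  rewrite rC; apply: lt_le_trans (linv_dist1_subr (prhon n) (rhon_linv n) _ _).
  rewrite ltrBrDr (le_lt_trans _ nkx)// lerD2l leNgt rC.
  by apply/negP => jan; apply: rho_small; exists n.
exists (closure N); split=> //.
- exact: closure_subgroup.
- exact: closure_invariant.
- exact: closed_closure.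
have [_ HM HV] := closure_subgroup sN.
move=> y j Hy z Hz B Bz.
(* Translate by [y], which preserves [H] and all averages. *)
have [|u [[Nu [du ru]] Byu]] := dense1 j _ (HM _ _ (HV _ Hy) Hz)
    [set u | B (y * u)%g].
  have yc : continuous (fun u : G => (y * u)%g).
    move=> u; apply: (@continuous_comp _ _ _ (fun v => (y, v))
      (fun p => p.1 * p.2)%g).
      by apply: cvg_pair => //; exact: cvg_cst.
    exact: mulg_continuous.
  by apply: yc; rewrite mulVKg.
exists (y * u)%g; split=> //; split; first exact/HM/subset_closure.
have E s n : left_invariant s ->
    mean_dist s T n y (y * u)%g = mean_dist s T n 1%g u :> R.
  by move=> sl; rewrite -{1}[y]mulg1 mean_dist_linv.
split; [case: du => n | case: ru => n]; rewrite -(E _ n)//; by exists n.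
Unshelve. all: by end_near. Qed.

Lemma extreme_points_dense (H K : set G) :
  completely_metrizable R G -> closed H -> countable K -> K `<=` H ->
  (forall y j, H y -> H `<=` closure (H `&` extreme_up_to j y)) ->
  H `<=` closure (H `&` \bigcap_(y in K) extreme y).
Proof.
move=> cG clH cK KH Hdense.
have -> : \bigcap_(y in K) extreme y =
    \bigcap_(p in K `*` setT) extreme_up_to p.2 p.1.
  apply/seteqP; split=> [z Kz [y j] [/= Ky _]|z Kz y Ky].
    by have := Kz y Ky; rewrite -bigcap_extreme_up_to; exact.
  by rewrite -bigcap_extreme_up_to => j _; exact: (Kz (y, j)).
apply: (Baire_closed_countable cG clH).
- exact: countableX.
- by move=> [y j] _; exact: open_extreme_up_to.
- by move=> [y j] [/= Ky _]; apply: Hdense; exact: KH.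
Qed.

(** A maximal pairwise extremely chaotic subset of [H] is uncountable, since a
    countable one can be enlarged by the Baire property; the new point is not
    in the old set because no point is chaotic with itself. *)
Lemma uncountable_extreme_set (H : set G) :
  completely_metrizable R G -> closed H -> H !=set0 ->
  (forall y j, H y -> H `<=` closure (H `&` extreme_up_to j y)) ->
  mean_LY_extremely_chaotic d rho T.
Proof.
move=> cG clH [h Hh] Hdense.
pose chaotic (K : set G) := K `<=` H /\
  forall x y, K x -> K y -> x <> y -> extreme x y.
have [F Fchaotic Ftot|K [[KH Kextreme] Kmax]] := @Zorn_bigcup _ chaotic.
  split=> [x [K FK Kx]|x y [K FK Kx] [K' FK' K'y]].
    by have [+ _] := Fchaotic _ FK; exact.
  have [KK'|K'K] := Ftot _ _ FK FK'.
    by have [_] := Fchaotic _ FK'; apply=> //; exact: KK'.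
  by have [_] := Fchaotic _ FK; apply=> //; exact: K'K.
exists K => // Kcount.
have [y [[Hy Ky] _]] :=
  extreme_points_dense cG clH Kcount KH Hdense Hh (@filterT _ (nbhs h) _).
have nKy : ~ K y by move=> /Ky; exact: extreme_pair_irrefl.
apply: (Kmax (K `|` [set y])).
  split; first exact: subsetUl.
  by move=> /(_ y (or_intror erefl)).
split=> [z [/KH//|->//]|a b [Ka|->] [Kb|->] ab].
- exact: Kextreme.
- exact: Ky.
- by apply: extreme_pair_sym; exact: Ky.
- by [].
Qed.

Lemma extremely_chaotic_pair :
  mean_LY_extremely_chaotic d rho T -> exists x y, extreme x y.
Proof.
move=> [K Kunc Kextreme]; apply: contrapT => no_pair; apply: Kunc.
have [[x Kx]|/set0P/negP/negPn/eqP->] := pselect (K !=set0); last first.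
  exact: countable0.
apply: sub_countable (countable1 x); apply: subset_card_le => y Ky /=.
apply: contrapT => yx; apply: no_pair; exists y, x.
exact: Kextreme.
Qed.

End MeanChaoticPairs.

(** * Restriction to a subgroup *)

Lemma set_val_iter_restrict (G : topologicalGroupType) (T : G -> G) (H : set G)
    (TH : invariant_set T H) n (x : H) :
  set_val (iter n (restrict_endo TH) x) = iter n T (set_val x).
Proof. by elim: n => [|n IH] //; rewrite [RHS]iterS -IH. Qed.

Lemma mean_irregular_restrict (R : realType) (G : topologicalGroupType)
    (d rho : G -> G -> R) (T : G -> G) (H : set G) (sH : is_subgroup H)
    (TH : invariant_set T H) (x : H) :
  mean_irregular (@restrict_dist R G d H) (@restrict_dist R G rho H)
    (restrict_endo TH) (subgroup_one sH) x =
  mean_irregular d rho T 1%g (set_val x).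
Proof.
have E s : orbit_mean_to (restrict_endo TH) (@restrict_dist R G s H) x
    (subgroup_one sH) = orbit_mean_to T s (set_val x) 1%g :> (nat -> \bar R).
  apply/funext => n; congr (_ * _)%:E; apply: eq_bigr => i _.
  by rewrite /restrict_dist set_val_iter_restrict.
by rewrite /mean_irregular !E.
Qed.

Lemma dense_subtype (X : topologicalType) (H S : set X) :
  H `<=` closure (H `&` S) -> dense [set x : H | S (set_val x)].
Proof.
move=> HS O [x Ox] [B opB BO]; move: Ox; rewrite -BO => Bx.
have [y [[Hy Sy] By]] := HS _ (set_valP x) B (open_nbhs_nbhs (conj opB Bx)).
by exists (SigSub (mem_set Hy)).
Qed.

Theorem theorem4p23 (R : realType) (G : topologicalGroupType)
  (G_cmet : completely_metrizable R G)
  (d : G -> G -> R) (d_compat : compatible_metric d)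
  (d_linv : left_invariant d)
  (rho : G -> G -> R) (rho_cont : continuous_pseudometric rho)
  (rho_linv : left_invariant rho)
  (T : {multiplicative G -> G}) (T_cont : continuous T)
  (d_bdd_or_T_lip : bounded_metric d \/ lipschitz_for d T) :
  [<-> exists x : G, mean_irregular d rho T 1%g x;
       exists x y : G, mean_LY_extreme_pair d rho T x y;
       mean_LY_extremely_chaotic d rho T;
       mean_LY_extremely_sensitive d rho T;
       exists (H : set G) (sH : is_subgroup H) (TH : invariant_set T H),
         closed H /\ dense_mean_irregular_restriction d rho sH TH].
Proof.
have pd : is_pseudometric d by case: d_compat => -[].
have residual x : mean_LY_extreme_pair d rho T x 1%g ->
    exists H, [/\ is_subgroup H, invariant_set T H, closed H &
      forall y j, H y -> H `<=` closure (H `&` extreme_up_to d rho T j y)].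
  exact: extreme_residual_subgroup.
tfae.
- by move=> [x]; rewrite mean_irregularE => x1; exists x, 1%g.
- move=> [x [y /(extreme_pair1 T d_compat d_linv rho_cont rho_linv)xy]].
  have [H [[H1 _ _] _ clH Hdense]] := residual _ xy.
  have Hn0 : H !=set0 by exists 1%g.
  exact: (uncountable_extreme_set d_compat rho_cont T_cont G_cmet clH Hn0
    Hdense).
- move=> /extremely_chaotic_pair[x [y]].
  move=> /(extreme_pair1 T d_compat d_linv rho_cont rho_linv).
  exact: extreme_pair_sensitive.
- move=> /(_ 1%g 1 ltr01)[x _].
  move=> /(extreme_pair_sym d_compat rho_cont)/residual[H [sH TH clH Hdense]].
  exists H, sH, TH; split=> //; rewrite /dense_mean_irregular_restriction.
  under eq_set do rewrite mean_irregular_restrict mean_irregularE.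
  apply: (@dense_subtype _ _ [set x | mean_LY_extreme_pair d rho T x 1%g]).
  have [H1 _ _] := sH.
  have sub1H : [set 1%g] `<=` H by move=> _ ->.
  have Hd := @extreme_points_dense _ _ _ _ _ d_compat rho_cont T_cont _ _
    G_cmet clH (countable1 1%g) sub1H Hdense.
  apply: (subset_trans Hd); rewrite bigcap_set1; apply: closureS.
  by apply: setIS => y; exact: extreme_pair_sym.
- move=> [H [sH [TH [_ /(_ setT)]]]].
  case=> [||x [_]].
  + by exists (subgroup_one sH).
  + exact: openT.
  + by rewrite /= mean_irregular_restrict; exists (set_val x).
Qed.
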